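(* Let $V$ be a smooth scheme over a field, let $\mathcal{G}=\bigoplus_n I_nW^n$ be a Rees algebra over $V$, let $x\in\mathrm{Sing}(\mathcal{G})$, and suppose that locally at $x$, $\mathcal{G}=\mathcal{O}_{V,x}[f_1W^{n_1},\dots,f_sW^{n_s}]$ with all $n_i\ge1$. Let $N>0$ be an integer which is a common multiple of all $n_i$, $i=1,\dots,s$, and let $\mathcal{G}_N=\mathcal{O}_V[I_NW^N]$ be the Rees ring attached to $I_N$. Then $\tau_{\mathcal{G},x}=\tau_{\mathcal{G}_N,x}$.
   Context: A Rees algebra over a smooth scheme $V$ is a graded subalgebra $\mathcal{G}=\bigoplus_{n\ge 0} I_nW^n$ of $\mathcal{O}_V[W]$ ($W$ a dummy variable), where the $I_n$ are sheaves of ideals with $I_0=\mathcal{O}_V$ and $I_sI_t\subset I_{s+t}$, which is locally a finitely generated $\mathcal{O}_V$-algebra. The singular locus is $\mathrm{Sing}(\mathcal{G})=\{x\in V : \nu_x(I_n)\ge n \text{ for all } n\ge 1\}$, with $\nu_x(I_n)$ the order of $I_n$ at $\mathcal{O}_{V,x}$. $\mathcal{G}_N=\mathcal{O}_V[I_NW^N]$ is the subalgebra of $\mathcal{O}_V[W]$ generated by $I_NW^N$, whose component of degree $mN$ is $I_N^m W^{mN}$ and whose components in degrees not divisible by $N$ are zero. For a Rees algebra $\mathcal{H}=\bigoplus J_nW^n$ and $x\in\mathrm{Sing}(\mathcal{H})$, with maximal ideal $\mathfrak{M}_x\subset\mathcal{O}_{V,x}$ and residue field $k(x)$, $\mathbb{I}_{\mathcal{H},x}$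 is the homogeneous ideal of $gr_{\mathfrak{M}_x}(\mathcal{O}_{V,x})$ generated by the images of $J_n$ in $\mathfrak{M}_x^n/\mathfrak{M}_x^{n+1}$ for all $n\ge1$. The cone $\mathcal{C}_{\mathcal{H}}\subset\mathbb{T}_{V,x}=\mathrm{Spec}(gr_{\mathfrak{M}_x}(\mathcal{O}_{V,x}))$ is the zero set of $\mathbb{I}_{\mathcal{H},x}$ (as a closed subset, equivalently reduced closed subscheme). The linear space of vertices $\mathcal{L}_{\mathcal{H},x}$ is the largest $k(x)$-linear subspace such that translation by each of its vectors maps $\mathcal{C}_{\mathcal{H}}$ onto itself. Hironaka's $\tau$-invariant $\tau_{\mathcal{H},x}$ is the codimension of $\mathcal{L}_{\mathcal{H},x}$ in $\mathbb{T}_{V,x}$. *)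

(* Defs.v *)
From HB Require Import structures.
From mathcomp Require Import all_boot all_order all_algebra.
From mathcomp Require Import boolp classical_sets functions topology.
From mathcomp Require Import -(notations) mpoly.

Set Implicit Arguments.
Unset Strict Implicit.
Unset Printing Implicit Defensive.

Import GRing.Theory.
Local Open Scope classical_set_scope.
Local Open Scope ring_scope.
Local Open Scope quotient_scope.

(* Rings of sections are [comPzRingType]s, because the ring of sections over
   the empty set is the zero ring. *)

Definition invertible (R : comPzRingType) (a : R) : Prop := exists b, a * b = 1.

Definition is_ideal (R : comPzRingType) (I : set R) : Prop :=
  [/\ I 0, forall a b, I a -> I b -> I (a + b) & forall a b, I b -> I (a * b)].

Definition prime_ideal (R : comPzRingType) (P : set R) : Prop :=
  [/\ is_ideal P, ~ P 1 & forall a b, P (a * b) -> P a \/ P b].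

Definition ideal_gen (R : comPzRingType) (S : set R) : set R :=
  [set a | forall I, is_ideal I -> S `<=` I -> I a].

Definition ideal_mul (R : comPzRingType) (I J : set R) : set R :=
  ideal_gen [set c | exists a b, [/\ I a, J b & c = a * b]].

Definition ideal_pow (R : comPzRingType) (I : set R) (n : nat) : set R :=
  iter n (ideal_mul I) setT.

Arguments ideal_pow : simpl never.

(* V(I), the set of points of Spec R where I vanishes *)
Definition zero_set (R : comPzRingType) (I : set R) : set (set R) :=
  [set P | prime_ideal P /\ I `<=` P].

Lemma ideal_gen_ideal (R : comPzRingType) (S : set R) : is_ideal (ideal_gen S).
Proof.
split=> [I []//|a b Ia Ib I idI SI|a b Ib I idI SI]; case: (idI) => _ HD HM.
  by apply: HD; [apply: Ia|apply: Ib].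
by apply: HM; apply: Ib.
Qed.

Lemma sub_ideal_gen (R : comPzRingType) (S : set R) : S `<=` ideal_gen S.
Proof. by move=> a Sa I _; apply. Qed.

Lemma ideal_pow_ideal (R : comPzRingType) (I : set R) n : is_ideal (ideal_pow I n).
Proof. by case: n => [|n]; [split|apply: ideal_gen_ideal]. Qed.

Lemma ideal_pow0 (R : comPzRingType) (I : set R) n : ideal_pow I n 0.
Proof. by case: (ideal_pow_ideal I n). Qed.

Lemma ideal_powD (R : comPzRingType) (I : set R) n a b :
  ideal_pow I n a -> ideal_pow I n b -> ideal_pow I n (a + b).
Proof. by case: (ideal_pow_ideal I n) => _ h _; apply: h. Qed.

Lemma ideal_powMl (R : comPzRingType) (I : set R) n a b :
  ideal_pow I n b -> ideal_pow I n (a * b).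
Proof. by case: (ideal_pow_ideal I n) => _ _ h; apply: h. Qed.

Lemma ideal_powN (R : comPzRingType) (I : set R) n a :
  ideal_pow I n a -> ideal_pow I n (- a).
Proof. by rewrite -mulN1r; apply: ideal_powMl. Qed.

Lemma ideal_pow_sum (R : comPzRingType) (I : set R) n (J : Type) (r : seq J) (P : pred J) F :
  (forall i, P i -> ideal_pow I n (F i)) ->
  ideal_pow I n (\sum_(i <- r | P i) F i).
Proof.
by move=> h; apply: big_ind => //; [apply: ideal_pow0|move=> *; apply: ideal_powD].
Qed.

Lemma ideal_pow_addn (R : comPzRingType) (I : set R) n p a b :
  ideal_pow I n a -> ideal_pow I p b -> ideal_pow I (n + p) (a * b).
Proof.
move=> + pb; elim: n a => [|n IHn] a na; first exact: ideal_powMl.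
pose J := [set c | ideal_pow I (n.+1 + p) (c * b)].
suff: J a by [].
apply: na.
  split; rewrite /J /=; first by rewrite mul0r; apply: ideal_pow0.
    by move=> c d Jc Jd; rewrite mulrDl; apply: ideal_powD.
  by move=> c d Jd; rewrite -mulrA; apply: ideal_powMl.
move=> _ [c [d [Ic nd ->]]]; rewrite /J /= -mulrA.
by apply: sub_ideal_gen; exists c, (d * b); split => //; apply: IHn.
Qed.

Lemma ideal_powW (R : comPzRingType) (I : set R) n : ideal_pow I n.+1 `<=` ideal_pow I n.
Proof.
move=> a; apply; first exact: ideal_pow_ideal.
by move=> _ [c [d [_ nd ->]]]; apply: ideal_powMl.
Qed.

Lemma ideal_pow_map (R S : comPzRingType) (f : {rmorphism R -> S})
    (I : set R) (J : set S) n a :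
  (forall b, I b -> J (f b)) -> ideal_pow I n a -> ideal_pow J n (f a).
Proof.
move=> fIJ; elim: n a => [//|n IHn] a na.
suff: [set c | ideal_pow J n.+1 (f c)] a by [].
apply: na.
  split=> /=; first by rewrite rmorph0; apply: ideal_pow0.
    by move=> c d *; rewrite rmorphD; apply: ideal_powD.
  by move=> c d *; rewrite rmorphM; apply: ideal_powMl.
move=> _ [c [d [Ic nd ->]]] /=; rewrite rmorphM.
by apply: sub_ideal_gen; exists (f c), (f d); split => //; [apply: fIJ|apply: IHn].
Qed.

HB.mixin Record isLocalRing R of GRing.ComNzRing R := {
  local_ringP : forall a : R, invertible a \/ invertible (1 - a)
}.

#[short(type="localRingType")]
HB.structure Definition LocalRing := {R of GRing.ComNzRing R & isLocalRing R}.

Definition max_ideal (R : localRingType) : set R := [set a | ~ invertible a].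
Arguments max_ideal : clear implicits.

Definition max_pow (R : localRingType) (n : nat) : set R :=
  ideal_pow (max_ideal R) n.
Arguments max_pow : clear implicits.

Lemma max_ideal_ideal (R : localRingType) : is_ideal (max_ideal R).
Proof.
have invM (a b : R) : invertible (a * b) -> invertible b.
  by case=> c abc; exists (a * c); rewrite mulrCA mulrA.
split=> [[b]|a b ma mb [c abc]|a b mb /invM//].
  by rewrite mul0r => /eqP; rewrite eq_sym oner_eq0.
case: (local_ringP (c * a)) => [/invM//|].
have -> : 1 - c * a = c * b by rewrite -abc mulrC mulrDr addrAC subrr add0r.
by move/invM.
Qed.

Lemma max_pow1 (R : localRingType) : max_pow R 1 `<=` max_ideal R.
Proof.
move=> a; apply; first exact: max_ideal_ideal.
move=> _ [c [d [mc _ ->]]]; rewrite mulrC.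
by case: (max_ideal_ideal R) => _ _; apply.
Qed.

Section AssociatedGraded.
Variable R : localRingType.

(* [reesRing] is the subring (+)_n M^n t^n of R[t]; gr_M(R) = (+)_n M^n/M^(n+1)
   is its quotient by the ideal (+)_n M^(n+1) t^n. *)
Definition rees_pred : {pred {poly R}} :=
  fun p => `[< forall n, max_pow R n p`_n >].

Lemma rees_predP (p : {poly R}) : reflect (forall n, max_pow R n p`_n) (p \in rees_pred).
Proof. exact: asboolP. Qed.

Lemma rees_pred_closed : subring_closed rees_pred.
Proof.
split=> [|p q /rees_predP hp /rees_predP hq|p q /rees_predP hp /rees_predP hq];
  apply/rees_predP => n.
- by rewrite coef1; case: n => [//|n]; apply: ideal_pow0.
- by rewrite coefB; apply: ideal_powD; [apply: hp|apply/ideal_powN/hq].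
- rewrite coefM; apply: ideal_pow_sum => i _.
  have {1}-> : n = (i + (n - i))%N by rewrite subnKC // -ltnS.
  by apply: ideal_pow_addn; [apply: hp|apply: hq].
Qed.
HB.instance Definition _ :=
  GRing.isSubringClosed.Build {poly R} rees_pred rees_pred_closed.

Record reesRing := ReesRing {
  rees_poly :> {poly R};
  rees_polyP : rees_poly \in rees_pred
}.
HB.instance Definition _ := [isSub for rees_poly].
HB.instance Definition _ := [Choice of reesRing by <:].
HB.instance Definition _ := [SubChoice_isSubComNzRing of reesRing by <:].

Definition gr_ideal : {pred reesRing} :=
  fun p => `[< forall n, max_pow R n.+1 (rees_poly p)`_n >].

Lemma gr_ideal_closed : idealr_closed gr_ideal.
Proof.
split.
- by apply/asboolP => n; rewrite coef0; apply: ideal_pow0.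
- apply/asboolP => /(_ 0%N); rewrite coef1 => /max_pow1; apply.
  by exists 1; rewrite mulr1.
- move=> a p q /asboolP hp /asboolP hq; apply/asboolP => n /=.
  rewrite coefD; apply: ideal_powD; last exact: hq.
  rewrite coefM; apply: ideal_pow_sum => i _.
  have {1}-> : n.+1 = (i + (n - i).+1)%N by rewrite addnS subnKC // -ltnS.
  apply: ideal_pow_addn; last exact: hp.
  exact: (rees_predP _ (rees_polyP a)).
Qed.
HB.instance Definition _ := isIdealr.Build reesRing gr_ideal gr_ideal_closed.

Definition gr : Type := {ideal_quot gr_ideal}.
HB.instance Definition _ := GRing.ComNzRing.on gr.

(* [gr_image n J] is the image of J in M^n/M^(n+1), the degree n part of gr,
   for a subset J of M^n (the elements of J outside M^n are ignored). *)
Definition gr_image (n : nat) (J : set R) : set gr :=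
  [set z | exists2 p : reesRing, z = \pi_gr p &
           exists2 a : R, J a & rees_poly p = a *: 'X^n].

Definition gr_deg (n : nat) : set gr := gr_image n setT.

(* k(x)-points of the tangent space Spec(gr), i.e. the k(x)-linear forms
   M/M^2 -> k(x).  The residue field k(x) = M^0/M^1 is [gr_deg 0] and M/M^2 is
   [gr_deg 1]; such a form is encoded by its extension by zero to the other
   homogeneous parts of gr, so that equal forms are equal functions. *)
Definition tangent_vector : set (gr -> gr) :=
  [set v | [/\ forall z, gr_deg 0 (v z),
               forall c z w, gr_deg 0 c -> v (c * z + w) = c * v z + v w &
               forall n z, n != 1%N -> gr_deg n z -> v z = 0]].

Definition linear_subspace (L : set (gr -> gr)) : Prop :=
  [/\ L `<=` tangent_vector, L (fun=> 0) &
      forall c v w, gr_deg 0 c -> L v -> L w -> L (fun z => c * v z + w z)].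

(* The translation of Spec(gr) by v is Spec(t) for the endomorphism t of the
   k(x)-algebra gr such that t z = z + v z on M/M^2; as gr is generated by
   M/M^2 over k(x), there is at most one such t, and there is one when R is
   regular, since gr is then the symmetric algebra of M/M^2. *)
Definition is_translation (v : gr -> gr) (t : {rmorphism gr -> gr}) : Prop :=
  (forall c, gr_deg 0 c -> t c = c) /\ (forall z, gr_deg 1 z -> t z = z + v z).

Definition translation_maps_onto_itself (C : set (set gr)) (v : gr -> gr) : Prop :=
  exists2 t : {rmorphism gr -> gr}, is_translation v t &
    [set t @^-1` P | P in C] = C.

Definition vertex_subspace (C : set (set gr)) (L : set (gr -> gr)) : Prop :=
  linear_subspace L /\ L `<=` translation_maps_onto_itself C.

(* The union of all subspaces by which C is invariant; it is the largest of
   them by [vertex_space_largest]. *)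
Definition vertex_space (C : set (set gr)) : set (gr -> gr) :=
  [set v | exists2 L, vertex_subspace C L & L v].

Lemma gr_deg0_0 : gr_deg 0 0.
Proof.
exists 0; first by rewrite rmorph0.
by exists 0; rewrite // scale0r.
Qed.

Lemma translation0 (C : set (set gr)) : translation_maps_onto_itself C (fun=> 0).
Proof.
exists (idfun : {rmorphism gr -> gr}).
  by split=> // z _; rewrite addr0.
by rewrite (_ : (fun P => _) = id) ?image_id //; apply/funext.
Qed.

Lemma translationD (C : set (set gr)) v w : tangent_vector w ->
  translation_maps_onto_itself C v -> translation_maps_onto_itself C w ->
  translation_maps_onto_itself C (fun z => v z + w z).
Proof.
case=> w0 _ _ [t [t0 t1] tC] [u [u0 u1] uC].
exists (t \o u : {rmorphism gr -> gr}); first split => /=.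
- by move=> c c0; rewrite u0 // t0.
- by move=> z z1; rewrite u1 // rmorphD t1 // t0 ?addrA.
- by rewrite -[RHS]uC -[in RHS]tC image_comp.
Qed.

Lemma vertex_space_largest (C : set (set gr)) :
  vertex_subspace C (vertex_space C) /\
  forall L, vertex_subspace C L -> L `<=` vertex_space C.
Proof.
split; last by move=> L CL v Lv; exists L.
split; last by move=> v [L [_ CL] /CL].
split.
- by move=> v [L [[LT _ _] _] /LT].
- exists [set (fun=> 0)] => //; split; last by move=> _ ->; apply: translation0.
  split=> [_ ->|//|c _ _ _ -> ->]; last by apply/funext => z; rewrite mulr0 addr0.
  by split=> [z|c z w _|//]; [apply: gr_deg0_0|rewrite mulr0 addr0].
- move=> c v w c0 [L1 [[T1 Z1 D1] C1] L1v] [L2 [[T2 Z2 D2] C2] L2w].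
  exists [set u | exists2 a, L1 a & exists2 b, L2 b & u = (fun z => a z + b z)];
    last first.
    exists (fun z => c * v z); last by exists w.
    have /= := D1 _ _ _ c0 L1v Z1.
    by rewrite (_ : (fun _ => _) = fun z => c * v z) //; apply/funext => z; rewrite addr0.
  split; last first.
    move=> _ [a /[dup] /C1 Ca La [b /[dup] /C2 Cb Lb ->]].
    by apply: translationD => //; apply: T2.
  split.
  + move=> _ [a /T1 [a0 aD aZ] [b /T2 [b0 bD bZ] ->]]; split=> [z|d z y d0|n z n1 zn].
    * have [p -> [r _ pr]] := a0 z; have [q -> [s _ qs]] := b0 z.
      exists (p + q); first by rewrite rmorphD.
      by exists (r + s) => //=; rewrite pr qs scalerDl.
    * by rewrite aD // bD // mulrDr addrACA.
    * by rewrite (aZ n) // (bZ n) // addr0.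
  + by exists (fun=> 0) => //; exists (fun=> 0) => //; apply/funext => z; rewrite addr0.
  + move=> d _ _ d0 [a La [b Lb ->]] [a' La' [b' Lb' ->]].
    exists (fun z => d * a z + a' z); first exact: D1.
    exists (fun z => d * b z + b' z); first exact: D2.
    by apply/funext => z; rewrite mulrDr addrACA.
Qed.

(* The quotient of the space of tangent vectors by L has a basis of n elements:
   every tangent vector has unique coordinates modulo L. *)
Definition has_codim (L : set (gr -> gr)) (n : nat) : Prop :=
  exists2 b : 'I_n -> gr -> gr, forall i, tangent_vector (b i) &
    forall v, tangent_vector v ->
      exists! c : 'I_n -> gr, (forall i, gr_deg 0 (c i)) /\
        L (fun z => v z - \sum_(i < n) c i * b i z).

(* 0 by convention if the codimension is infinite *)
Definition codim (L : set (gr -> gr)) : nat := xget 0%N (has_codim L).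

End AssociatedGraded.

Identity Coercion set_to_fun : set >-> Funclass.

Record opens (X : topologicalType) := Opens {
  opens_set :> set X;
  opens_open : open opens_set
}.

Definition opensT (X : topologicalType) : opens X := Opens openT.

Lemma sub_opensT (X : topologicalType) (U : opens X) : U `<=` opensT X.
Proof. by []. Qed.

Definition opensI (X : topologicalType) (U V : opens X) : opens X :=
  Opens (openI (opens_open U) (opens_open V)).

Lemma opensIl (X : topologicalType) (U V : opens X) : opensI U V `<=` U.
Proof. by move=> ? []. Qed.

Lemma opensIr (X : topologicalType) (U V : opens X) : opensI U V `<=` V.
Proof. by move=> ? []. Qed.

(* [lrs_nontrivial] and [lrs_local] say that the stalks are local rings. *)
Record locally_ringed_space := LocallyRingedSpace {
  lrs_space :> topologicalType;
  sections : opens lrs_space -> comPzRingType;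
  res : forall U V : opens lrs_space, V `<=` U ->
    {rmorphism sections U -> sections V};
  res_id : forall (U : opens lrs_space) (UU : U `<=` U) s, res UU s = s;
  res_comp : forall (U V W : opens lrs_space)
    (VU : V `<=` U) (WV : W `<=` V) (WU : W `<=` U) s,
    res WV (res VU s) = res WU s;
  lrs_sheaf : forall (J : Type) (U : opens lrs_space) (W : J -> opens lrs_space)
    (WU : forall j, W j `<=` U) (s : forall j, sections (W j)),
    U `<=` \bigcup_j W j ->
    (forall i j (Z : opens lrs_space) (Zi : Z `<=` W i) (Zj : Z `<=` W j),
      res Zi (s i) = res Zj (s j)) ->
    exists! t : sections U, forall j, res (WU j) t = s j;
  lrs_nontrivial : forall U : opens lrs_space, U !=set0 ->
    (1 : sections U) != 0;
  lrs_local : forall (U : opens lrs_space) x (s : sections U), U x ->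
    exists2 W : opens lrs_space, W x & exists WU : W `<=` U,
      invertible (res WU s) \/ invertible (1 - res WU s)
}.

Section Stalk.
Variables (X : locally_ringed_space) (x : X).

Record pregerm := Pregerm {
  pregerm_dom : opens X;
  pregerm_in : pregerm_dom x;
  pregerm_sec : sections pregerm_dom
}.
HB.instance Definition _ := gen_eqMixin pregerm.
HB.instance Definition _ := gen_choiceMixin pregerm.

Definition germ_eq (g h : pregerm) : bool :=
  `[< exists2 W : opens X, W x &
      exists (Wg : W `<=` pregerm_dom g) (Wh : W `<=` pregerm_dom h),
        res Wg (pregerm_sec g) = res Wh (pregerm_sec h) >].

Lemma germ_eq_equiv : equiv_class_of germ_eq.
Proof.
have refl : reflexive germ_eq.
  move=> [U Ux s]; apply/asboolP; exists U => //=.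
  by exists (@subset_refl _ U), (@subset_refl _ U).
have sym g h : germ_eq g h -> germ_eq h g.
  move=> /asboolP [W Wx [Wg [Wh E]]]; apply/asboolP.
  by exists W => //; exists Wh, Wg.
split=> // [g h|h g i]; first by apply/idP/idP; apply: sym.
move=> /asboolP [W Wx [Wg [Wh E]]] /asboolP [W' W'x [W'h [W'i E']]].
apply/asboolP; exists (opensI W W') => //=.
have l : opensI W W' `<=` W by move=> ? [].
have r : opensI W W' `<=` W' by move=> ? [].
exists (subset_trans l Wg), (subset_trans r W'i).
rewrite -(res_comp Wg l) -(res_comp W'i r) E -E'.
by rewrite (res_comp _ _ (subset_trans l Wh)) (res_comp _ _ (subset_trans l Wh)).
Qed.

Canonical germ_eq_equivRel := EquivRelPack germ_eq_equiv.
Canonical germ_eq_encModRel := defaultEncModRel germ_eq.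

Definition stalk : Type := {eq_quot germ_eq}.
HB.instance Definition _ := Choice.on stalk.
HB.instance Definition _ : EqQuotient pregerm germ_eq stalk := EqQuotient.on stalk.

Definition germ (U : opens X) (Ux : U x) (s : sections U) : stalk :=
  \pi_stalk (Pregerm Ux s).

Lemma germP (U V : opens X) (Ux : U x) (Vx : V x) s t :
  germ Ux s = germ Vx t <->
  exists2 W : opens X, W x & exists (WU : W `<=` U) (WV : W `<=` V),
    res WU s = res WV t.
Proof.
split=> [/eqP|h]; first by rewrite piE => /asboolP.
by apply/eqP; rewrite piE; apply/asboolP.
Qed.

Lemma germ_res (U V : opens X) (Ux : U x) (Vx : V x) (VU : V `<=` U) s :
  germ Vx (res VU s) = germ Ux s.
Proof.
apply/germP; exists V => //; exists (@subset_refl _ V), VU.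
by rewrite res_id.
Qed.

Lemma stalkP (a : stalk) : exists (U : opens X) (Ux : U x) s, a = germ Ux s.
Proof.
case E : (repr a) => [U Ux s]; exists U, Ux, s.
by rewrite -[a]reprK E.
Qed.

Lemma stalkP2 (a b : stalk) : exists (U : opens X) (Ux : U x) s t,
  a = germ Ux s /\ b = germ Ux t.
Proof.
have [U [Ux [s ->]]] := stalkP a; have [V [Vx [t ->]]] := stalkP b.
have l : opensI U V `<=` U by move=> ? [].
have r : opensI U V `<=` V by move=> ? [].
have Wx : opensI U V x by [].
by exists (opensI U V), Wx, (res l s), (res r t); rewrite !germ_res.
Qed.

Lemma stalkP3 (a b c : stalk) : exists (U : opens X) (Ux : U x) s t u,
  [/\ a = germ Ux s, b = germ Ux t & c = germ Ux u].
Proof.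
have [U [Ux [s [t [-> ->]]]]] := stalkP2 a b; have [V [Vx [u ->]]] := stalkP c.
have l : opensI U V `<=` U by move=> ? [].
have r : opensI U V `<=` V by move=> ? [].
have Wx : opensI U V x by [].
by exists (opensI U V), Wx, (res l s), (res l t), (res r u); rewrite !germ_res.
Qed.

Definition pregerm_op (op : forall U : opens X, sections U -> sections U -> sections U)
    (g h : pregerm) : pregerm :=
  Pregerm (conj (pregerm_in g) (pregerm_in h) :
             opensI (pregerm_dom g) (pregerm_dom h) x)
    (op (opensI (pregerm_dom g) (pregerm_dom h))
      (res (@opensIl _ _ _) (pregerm_sec g))
      (res (@opensIr _ _ _) (pregerm_sec h))).

Definition stalk_op op (a b : stalk) : stalk :=
  \pi_stalk (pregerm_op op (repr a) (repr b)).

Definition stalk_zero : stalk := @germ (opensT X) I 0.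
Definition stalk_one : stalk := @germ (opensT X) I 1.
Definition stalk_opp (a : stalk) : stalk :=
  germ (pregerm_in (repr a)) (- pregerm_sec (repr a)).
Definition stalk_add := stalk_op (fun U => +%R).
Definition stalk_mul := stalk_op (fun U => *%R).

Lemma stalk_opE (op : forall U : opens X, sections U -> sections U -> sections U)
    (opE : forall (U V : opens X) (VU : V `<=` U) s t,
      res VU (op U s t) = op V (res VU s) (res VU t))
    (U : opens X) (Ux : U x) s t :
  stalk_op op (germ Ux s) (germ Ux t) = germ Ux (op U s t).
Proof.
rewrite /stalk_op.
case Es : (repr (germ Ux s)) => [U1 U1x s1]; case Et : (repr (germ Ux t)) => [U2 U2x t1].
have /germP[W1 W1x [W1U1 [W1U E1]]] : germ U1x s1 = germ Ux s.
  by rewrite -[RHS]reprK Es.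
have /germP[W2 W2x [W2U2 [W2U E2]]] : germ U2x t1 = germ Ux t.
  by rewrite -[RHS]reprK Et.
apply/germP => /=; exists (opensI W1 W2) => //=.
have l : opensI W1 W2 `<=` W1 by move=> ? [].
have r : opensI W1 W2 `<=` W2 by move=> ? [].
have h : opensI W1 W2 `<=` opensI U1 U2 by move=> ? [/W1U1 ? /W2U2 ?].
exists h, (subset_trans l W1U); rewrite !opE.
rewrite (res_comp _ _ (subset_trans l W1U1)) -(res_comp W1U1 l) E1.
rewrite (res_comp _ _ (subset_trans r W2U2)) -(res_comp W2U2 r) E2.
by rewrite (res_comp _ _ (subset_trans l W1U)) (res_comp _ _ (subset_trans l W1U)).
Qed.

Lemma stalk_addE (U : opens X) (Ux : U x) s t :
  stalk_add (germ Ux s) (germ Ux t) = germ Ux (s + t).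
Proof. by apply: stalk_opE => V W *; rewrite rmorphD. Qed.

Lemma stalk_mulE (U : opens X) (Ux : U x) s t :
  stalk_mul (germ Ux s) (germ Ux t) = germ Ux (s * t).
Proof. by apply: stalk_opE => V W *; rewrite rmorphM. Qed.

Lemma stalk_oppE (U : opens X) (Ux : U x) s : stalk_opp (germ Ux s) = germ Ux (- s).
Proof.
rewrite /stalk_opp; case Es : (repr (germ Ux s)) => [U1 U1x s1] /=.
have /germP[W Wx [WU1 [WU E]]] : germ U1x s1 = germ Ux s.
  by rewrite -[RHS]reprK Es.
by apply/germP; exists W => //; exists WU1, WU; rewrite !rmorphN E.
Qed.

Lemma stalk_zeroE (U : opens X) (Ux : U x) : stalk_zero = germ Ux 0.
Proof.
apply/germP; exists U => //; exists (@subsetT _ U), (@subset_refl _ U).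
by rewrite !rmorph0.
Qed.

Lemma stalk_oneE (U : opens X) (Ux : U x) : stalk_one = germ Ux 1.
Proof.
apply/germP; exists U => //; exists (@subsetT _ U), (@subset_refl _ U).
by rewrite !rmorph1.
Qed.

Lemma stalk_addA : associative stalk_add.
Proof.
move=> a b c; have [U [Ux [s [t [u [-> -> ->]]]]]] := stalkP3 a b c.
by rewrite !stalk_addE addrA.
Qed.

Lemma stalk_addC : commutative stalk_add.
Proof.
move=> a b; have [U [Ux [s [t [-> ->]]]]] := stalkP2 a b.
by rewrite !stalk_addE addrC.
Qed.

Lemma stalk_add0 : left_id stalk_zero stalk_add.
Proof.
move=> a; have [U [Ux [s ->]]] := stalkP a.
by rewrite (stalk_zeroE Ux) stalk_addE add0r.
Qed.

Lemma stalk_addN : left_inverse stalk_zero stalk_opp stalk_add.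
Proof.
move=> a; have [U [Ux [s ->]]] := stalkP a.
by rewrite stalk_oppE stalk_addE addNr (stalk_zeroE Ux).
Qed.

Lemma stalk_mulA : associative stalk_mul.
Proof.
move=> a b c; have [U [Ux [s [t [u [-> -> ->]]]]]] := stalkP3 a b c.
by rewrite !stalk_mulE mulrA.
Qed.

Lemma stalk_mulC : commutative stalk_mul.
Proof.
move=> a b; have [U [Ux [s [t [-> ->]]]]] := stalkP2 a b.
by rewrite !stalk_mulE mulrC.
Qed.

Lemma stalk_mul1 : left_id stalk_one stalk_mul.
Proof.
move=> a; have [U [Ux [s ->]]] := stalkP a.
by rewrite (stalk_oneE Ux) stalk_mulE mul1r.
Qed.

Lemma stalk_mulDl : left_distributive stalk_mul stalk_add.
Proof.
move=> a b c; have [U [Ux [s [t [u [-> -> ->]]]]]] := stalkP3 a b c.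
by rewrite stalk_addE !stalk_mulE stalk_addE mulrDl.
Qed.

Lemma stalk_1neq0 : stalk_one != stalk_zero.
Proof.
apply/eqP => /germP[W Wx [l [r]]]; rewrite rmorph1 rmorph0 => /eqP.
by apply/negP/lrs_nontrivial; exists x.
Qed.

HB.instance Definition _ :=
  GRing.isZmodule.Build stalk stalk_addA stalk_addC stalk_add0 stalk_addN.
HB.instance Definition _ := GRing.Zmodule_isComNzRing.Build stalk
  stalk_mulA stalk_mulC stalk_mul1 stalk_mulDl stalk_1neq0.

Lemma stalk_local (a : stalk) : invertible a \/ invertible (1 - a).
Proof.
have [U [Ux [s ->]]] := stalkP a.
have [W Wx [WU [[b Eb]|[b Eb]]]] := lrs_local s Ux; [left|right]; exists (germ Wx b).
  rewrite -(germ_res Ux Wx WU); transitivity (stalk_mul (germ Wx (res WU s)) (germ Wx b)) => //.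
  by rewrite stalk_mulE Eb -stalk_oneE.
rewrite -(germ_res Ux Wx WU).
transitivity (stalk_mul (stalk_add stalk_one (stalk_opp (germ Wx (res WU s)))) (germ Wx b)) => //.
by rewrite stalk_oppE (stalk_oneE Wx) stalk_addE stalk_mulE Eb -stalk_oneE.
Qed.
HB.instance Definition _ := isLocalRing.Build stalk stalk_local.

End Stalk.

Section Schemes.
Variable X : locally_ringed_space.

Definition nonvanishing_locus (U : opens X) (f : sections U) : set X :=
  [set x | exists2 W : opens X, W x & exists WU : W `<=` U, invertible (res WU f)].

(* phi identifies B with the localization A_f *)
Definition is_localization_away (A B : comPzRingType) (phi : {rmorphism A -> B})
    (f : A) : Prop :=
  [/\ invertible (phi f),
      forall b, exists a n, phi f ^+ n * b = phi a &
      forall a, phi a = 0 -> exists n, f ^+ n * a = 0].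

(* (U, O_U) is isomorphic to Spec(O(U)): the canonical map sending x to the
   prime ideal of the sections vanishing at x is a bijection from U onto
   Spec(O(U)), it is a homeomorphism for the Zariski topology, whose basis is
   given by the D(f), and O(D(f)) is the localization of O(U) at f. *)
Definition is_affine (U : opens X) : Prop :=
  [/\ set_bij U [set P : set (sections U) | prime_ideal P]
        (fun x => [set f | ~ nonvanishing_locus f x]),
      forall (W : opens X) x, U x -> W x ->
        exists2 f : sections U, nonvanishing_locus f x & nonvanishing_locus f `<=` W &
      forall (f : sections U) (D : opens X) (DU : D `<=` U),
        D = nonvanishing_locus f :> set X -> is_localization_away (res DU) f].

End Schemes.

Record scheme := Scheme {
  scheme_lrs :> locally_ringed_space;
  scheme_affine : forall x : scheme_lrs,
    exists2 U : opens scheme_lrs, U x & is_affine U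
}.

(* A ~ k[X_1, ..., X_(c+d)]/(F_1, ..., F_c), where the minor of the Jacobian
   matrix of F on the first c variables is invertible in A *)
Definition standard_smooth (k : fieldType) (A : comPzRingType)
    (iota : {rmorphism k -> A}) : Prop :=
  exists (c d : nat) (F : 'I_c -> mpoly (c + d) k)
         (phi : {rmorphism mpoly (c + d) k -> A}),
  [/\ forall a, phi (mpolyC (c + d) a) = iota a,
      forall a, exists p, phi p = a,
      [set p | phi p = 0] = ideal_gen (range F) &
      invertible (phi (\det (\matrix_(i < c, j < c) mderiv (lshift d j) (F i))))].

(* The structure morphism V -> Spec(k) is given by k -> O(V). *)
Definition smooth (k : fieldType) (V : scheme)
    (iota : {rmorphism k -> sections (opensT V)}) : Prop :=
  forall x : V, exists2 U : opens V, U x &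
    is_affine U /\
    standard_smooth (res (sub_opensT (U := U)) \o iota : {rmorphism k -> sections U}).

Record ideal_sheaf (V : scheme) := IdealSheaf {
  ideal_sections :> forall U : opens V, set (sections U);
  ideal_sections_ideal : forall U, is_ideal (@ideal_sections U);
  ideal_sections_res : forall (U W : opens V) (WU : W `<=` U) s,
    ideal_sections s -> ideal_sections (res WU s);
  ideal_sections_local : forall (U : opens V) (s : sections U),
    (forall x, U x -> exists2 W : opens V, W x &
       exists WU : W `<=` U, ideal_sections (res WU s)) ->
    ideal_sections s
}.
Arguments ideal_sections {V} i U.

Definition ideal_stalk (V : scheme) (I : ideal_sheaf V) (x : V) : set (stalk x) :=
  [set a | exists (U : opens V) (Ux : U x) s, I U s /\ a = germ Ux s].
Arguments ideal_stalk {V} I x.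

(* The graded subalgebra (+)_n I_n W^n of O_V[W] is given by its components I_n. *)
Record graded_algebra (V : scheme) := GradedAlgebra {
  component :> nat -> ideal_sheaf V;
  component0 : forall U s, component 0 U s;
  componentM : forall i j U s t,
    component i U s -> component j U t -> component (i + j)%N U (s * t)
}.

Definition subalgebra (R : comNzRingType) (B : set {poly R}) : Prop :=
  [/\ forall c : R, B c%:P, forall p q, B p -> B q -> B (p + q) &
      forall p q, B p -> B q -> B (p * q)].

Definition subalgebra_gen (R : comNzRingType) (S : set {poly R}) : set {poly R} :=
  [set p | forall B, subalgebra B -> S `<=` B -> B p].

(* The stalk of H at x is O_{V,x}[f_0 W^(n_0), ..., f_(s-1) W^(n_(s-1))]. *)
Definition generated_at (V : scheme) (H : graded_algebra V) (x : V) (s : nat)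
    (f : 'I_s -> stalk x) (n : 'I_s -> nat) : Prop :=
  [set p : {poly stalk x} | forall i, ideal_stalk (H i) x p`_i] =
  subalgebra_gen (range (fun i => f i *: 'X^(n i))).

Record rees_algebra (V : scheme) := ReesAlgebra {
  rees_graded :> graded_algebra V;
  rees_locally_fg : forall x : V, exists2 U : opens V, U x &
    exists (s : nat) (f : 'I_s -> sections U) (n : 'I_s -> nat),
      forall y (Uy : U y), generated_at rees_graded (fun i => germ Uy (f i)) n
}.

Section ReesOfIdeal.
Variables (V : scheme) (I : ideal_sheaf V) (N : nat).

(* The component of O_V[I W^N] of degree m N is I^m (the sheaf associated with
   the powers of the ideals of sections), the others are zero. *)
Definition rees_of_ideal_sections (n : nat) (U : opens V) : set (sections U) :=
  if (N %| n)%N then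
    [set s | forall x, U x -> exists2 W : opens V, W x &
       exists WU : W `<=` U, ideal_pow (I W) (n %/ N) (res WU s)]
  else [set 0].

Lemma rees_of_ideal_ideal n U : is_ideal (@rees_of_ideal_sections n U).
Proof.
rewrite /rees_of_ideal_sections; case: ifP => _; last first.
  by split=> [//|a b -> ->|a b ->]; rewrite ?addr0 ?mulr0.
split=> [x Ux|a b Ia Ib x Ux|a b Ib x Ux].
- by exists U => //; exists (@subset_refl _ U); rewrite rmorph0; apply: ideal_pow0.
- have [W Wx [WU Wa]] := Ia x Ux; have [W' W'x [W'U W'b]] := Ib x Ux.
  exists (opensI W W') => //.
  have l : opensI W W' `<=` W by move=> ? [].
  have r : opensI W W' `<=` W' by move=> ? [].
  exists (subset_trans l WU); rewrite rmorphD; apply: ideal_powD.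
    rewrite -(res_comp WU l); apply: ideal_pow_map Wa => s.
    exact: ideal_sections_res.
  rewrite -(res_comp W'U r); apply: ideal_pow_map W'b => s.
  exact: ideal_sections_res.
- have [W Wx [WU Wb]] := Ib x Ux; exists W => //; exists WU.
  by rewrite rmorphM; apply: ideal_powMl.
Qed.

Lemma rees_of_ideal_res n (U W : opens V) (WU : W `<=` U) s :
  rees_of_ideal_sections n s -> rees_of_ideal_sections n (res WU s).
Proof.
rewrite /rees_of_ideal_sections; case: ifP => _; last by move=> ->; rewrite /= rmorph0.
move=> Us x Wx; have [Z Zx [ZU Zs]] := Us x (WU _ Wx).
have l : opensI W Z `<=` W by move=> ? [].
have r : opensI W Z `<=` Z by move=> ? [].
exists (opensI W Z) => //; exists l.
rewrite (res_comp _ _ (subset_trans r ZU)) -(res_comp ZU r).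
by apply: ideal_pow_map Zs => t; apply: ideal_sections_res.
Qed.

Lemma rees_of_ideal_local n (U : opens V) (s : sections U) :
  (forall x, U x -> exists2 W : opens V, W x &
     exists WU : W `<=` U, rees_of_ideal_sections n (res WU s)) ->
  rees_of_ideal_sections n s.
Proof.
rewrite /rees_of_ideal_sections; case: ifP => _ Us.
  move=> x Ux; have [W Wx [WU Ws]] := Us x Ux; have [Z Zx [ZW Zs]] := Ws x Wx.
  exists Z => //; exists (subset_trans ZW WU).
  by rewrite -(res_comp WU ZW).
pose J := {W : opens V | exists WU : W `<=` U, res WU s = 0}.
have JU (j : J) : sval j `<=` U by case: (svalP j).
have [] := @lrs_sheaf V J U (fun j => sval j) JU (fun=> 0).
- move=> x Ux; have [W Wx [WU Ws]] := Us x Ux.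
  have WJ : exists WU : W `<=` U, res WU s = 0 by exists WU.
  by exists (exist _ W WJ).
- by move=> i j Z Zi Zj; rewrite !rmorph0.
move=> t [_ t_uniq]; rewrite /= -(t_uniq 0); last by move=> j; rewrite rmorph0.
apply/esym/t_uniq => j; have [WU Ws] := svalP j.
by rewrite -[RHS]Ws (Prop_irrelevance (JU j) WU).
Qed.

Definition rees_of_ideal_component (n : nat) : ideal_sheaf V :=
  IdealSheaf (rees_of_ideal_ideal n) (@rees_of_ideal_res n) (@rees_of_ideal_local n).

Lemma rees_of_ideal0 U s : rees_of_ideal_component 0 U s.
Proof.
rewrite /= /rees_of_ideal_sections dvdn0 => x Ux.
by exists U => //; exists (@subset_refl _ U); rewrite div0n.
Qed.

Lemma rees_of_idealM i j U s t :
  rees_of_ideal_component i U s -> rees_of_ideal_component j U t ->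
  rees_of_ideal_component (i + j)%N U (s * t).
Proof.
have [h0 _ _] := rees_of_ideal_ideal (i + j) U.
move: h0; rewrite /= /rees_of_ideal_sections.
case: (boolP (N %| i)%N) => [Ni|_]; last by move=> h0 -> _; rewrite mul0r.
case: (boolP (N %| j)%N) => [Nj|_]; last by move=> h0 _ ->; rewrite mulr0.
rewrite dvdn_add // => _ Is It x Ux.
have [W Wx [WU Ws]] := Is x Ux; have [W' W'x [W'U W't]] := It x Ux.
exists (opensI W W') => //.
have l : opensI W W' `<=` W by move=> ? [].
have r : opensI W W' `<=` W' by move=> ? [].
exists (subset_trans l WU); rewrite rmorphM divnDl //; apply: ideal_pow_addn.
  rewrite -(res_comp WU l); apply: ideal_pow_map Ws => u.
  exact: ideal_sections_res.
rewrite -(res_comp W'U r); apply: ideal_pow_map W't => u.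
exact: ideal_sections_res.
Qed.

Definition rees_of_ideal : graded_algebra V :=
  GradedAlgebra rees_of_ideal0 rees_of_idealM.

End ReesOfIdeal.

(* nu(J) >= n, where nu(J) is the largest r such that J is contained in M^r
   (and is infinite if there is no largest one). *)
Definition order_ge (R : localRingType) (J : set R) (n : nat) : Prop :=
  J `<=` max_pow R n.

Definition Sing (V : scheme) (H : graded_algebra V) : set V :=
  [set x | forall n, (0 < n)%N -> order_ge (ideal_stalk (H n) x) n].

Definition initial_ideal (V : scheme) (H : graded_algebra V) (x : V) :
    set (gr (stalk x)) :=
  ideal_gen (\bigcup_(n in [set n | (0 < n)%N]) gr_image n (ideal_stalk (H n) x)).
Arguments initial_ideal {V} H x.

Definition tangent_cone (V : scheme) (H : graded_algebra V) (x : V) :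
    set (set (gr (stalk x))) :=
  zero_set (initial_ideal H x).
Arguments tangent_cone {V} H x.

Definition tau (V : scheme) (H : graded_algebra V) (x : V) : nat :=
  codim (vertex_space (tangent_cone H x)).

(* Main.v *)
Require Import Defs.
From HB Require Import structures.
From mathcomp Require Import all_boot all_order all_algebra.
From mathcomp Require Import boolp classical_sets functions topology.

Set Implicit Arguments.
Unset Strict Implicit.
Unset Printing Implicit Defensive.

(* A prime of gr contains the initial ideal of G as soon as it contains the
   initial forms of the generators f_i W^(n_i).  With m = N / n_i, the m-th power
   of such a form is the form of f_i^m, which lies in I_N, the degree N part of
   G_N.  Hence G and G_N have the same tangent cone, and the same tau. *)

Import GRing.Theory.
Local Open Scope classical_set_scope.
Local Open Scope ring_scope.
Local Open Scope quotient_scope.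

Section GradedPieces.
Variable R : localRingType.
Implicit Types (n : nat) (a : R) (P : set (gr R)).

Lemma rees_monomial n a : max_pow R n a ->
  exists r : reesRing R, rees_poly r = a *: 'X^n.
Proof.
move=> na; suff aX : a *: 'X^n \in @rees_pred R by exists (ReesRing aX).
apply/rees_predP => i; rewrite coefZ coefXn.
by case: eqP => [->|_]; rewrite ?mulr1 // mulr0; apply: ideal_pow0.
Qed.

(* In terms of initial forms: a lies in M^n and its class in M^n/M^(n+1) is in P. *)
Definition form_in P n a : Prop :=
  exists2 r : reesRing R, rees_poly r = a *: 'X^n & P (\pi_(gr R) r).

(** An element of [reesRing] is determined by its polynomial, so the witness hidden in [form_in] can
    be exchanged for any other one. *)
Lemma form_inE P n a (r : reesRing R) :
  rees_poly r = a *: 'X^n -> form_in P n a -> P (\pi_(gr R) r).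
Proof. by move=> ra [r' r'a Pr']; rewrite (_ : r = r') //; apply: val_inj; rewrite /= ra. Qed.

Lemma form_in0 P n : is_ideal P -> form_in P n 0.
Proof. by case=> P0 _ _; exists 0; rewrite ?scale0r ?rmorph0. Qed.

Lemma form_inD P n a b : is_ideal P ->
  form_in P n a -> form_in P n b -> form_in P n (a + b).
Proof.
case=> _ PD _ [p pa Pp] [q qb Pq]; exists (p + q); first by rewrite /= pa qb scalerDl.
by rewrite rmorphD; apply: PD.
Qed.

Lemma form_inM P i j a b : is_ideal P -> max_pow R i a ->
  form_in P j b -> form_in P (i + j) (a * b).
Proof.
case=> _ _ PM /rees_monomial[p pa] [q qb Pq]; exists (p * q).
  by rewrite /= pa qb -scalerAl -scalerAr scalerA exprD.
by rewrite rmorphM; apply: PM.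
Qed.

Lemma form_in_max P n a : form_in P n a -> max_pow R n a.
Proof.
case=> r ra _; have /rees_predP/(_ n) := rees_polyP r.
by rewrite ra coefZ coefXn eqxx mulr1.
Qed.

Lemma prime_idealX P (z : gr R) m : prime_ideal P -> P (z ^+ m) -> P z.
Proof.
case=> _ P1 PM; elim: m => [|m IHm]; first by rewrite expr0.
by rewrite exprS => /PM[].
Qed.

(** If [r] represents the form of [a], then [r ^+ m] represents that of [a ^+ m] in degree [n * m],
    and a prime ideal is radical. *)
Lemma form_inX P n m a : prime_ideal P -> max_pow R n a ->
  form_in P (n * m) (a ^+ m) -> form_in P n a.
Proof.
move=> primeP /rees_monomial[r ra] am; exists r => //.
apply: (@prime_idealX _ _ m) => //; rewrite -rmorphXn; apply: form_inE am.
by rewrite -[rees_poly _]/(val _) rmorphXn /= ra exprZn exprM.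
Qed.

(* In degree 0 nothing is asked, as the constants must belong to a subalgebra. *)
Lemma form_in_subalgebra P : is_ideal P ->
  subalgebra [set p : {poly R} | forall n, (0 < n)%N -> form_in P n p`_n].
Proof.
move=> idP; split=> [c n n0|p q Pp Pq n n0|p q Pp Pq n n0].
- by rewrite coefC -[n == _]negbK -lt0n n0; apply: form_in0.
- by rewrite coefD; apply: form_inD; [|apply: Pp|apply: Pq].
have max_coef (u : {poly R}) i :
    (forall j, (0 < j)%N -> form_in P j u`_j) -> max_pow R i u`_i.
  by case: i => [//|i] /(_ i.+1 isT)/form_in_max.
rewrite coefM; apply: big_ind => [|a b|i _]; first exact: form_in0.
  exact: form_inD.
have le_in : (i <= n)%N by rewrite -ltnS.
(* As [n] is positive, [i] and [n - i] are not both zero. A factor of positive degree has its form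
   in [P]; the other one only has to lie in its power of the maximal ideal. *)
have [i0|i0] := posnP i.
  rewrite -[X in form_in _ X](subnKC le_in).
  by apply: form_inM; [|apply: max_coef|apply: Pq; rewrite i0 subn0].
rewrite -[X in form_in _ X](subnK le_in) mulrC.
by apply: form_inM; [|apply: max_coef|apply: Pp].
Qed.

End GradedPieces.

Section IdealStalks.
Variables (V : scheme) (x : V).

Lemma component_exp (H : graded_algebra V) i m (U : opens V) (s : sections U) :
  H i U s -> H (i * m)%N U (s ^+ m).
Proof.
move=> Hs; elim: m => [|m IHm]; first by rewrite muln0; apply: component0.
by rewrite mulnS exprS; apply: componentM.
Qed.

Lemma component_ideal_pow (H : graded_algebra V) i m (U : opens V) :
  ideal_pow (H i U) m `<=` H (m * i)%N U.
Proof.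
elim: m => [|m IHm] s; first by move=> _; rewrite mul0n; apply: component0.
apply; first exact: ideal_sections_ideal.
by move=> _ [a [b [Ha mb ->]]]; rewrite mulSn; apply: componentM => //; apply: IHm.
Qed.

Lemma germX (U : opens V) (Ux : U x) (s : sections U) m :
  germ Ux (s ^+ m) = germ Ux s ^+ m.
Proof.
elim: m => [|m IHm]; first by rewrite !expr0 -stalk_oneE.
by rewrite !exprS -IHm -stalk_mulE.
Qed.

Lemma ideal_stalk_exp (H : graded_algebra V) i m (a : stalk x) :
  ideal_stalk (H i) x a -> ideal_stalk (H (i * m)%N) x (a ^+ m).
Proof.
move=> [U [Ux [s [Hs ->]]]]; exists U, Ux, (s ^+ m).
by split; [apply: component_exp|rewrite germX].
Qed.

(** If [N] divides [i], sections lie locally in the power [i %/ N] of [H N], hence in [H i] by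
    multiplicativity; in other degrees they vanish. *)
Lemma ideal_stalk_rees_of_ideal (H : graded_algebra V) N i :
  ideal_stalk (rees_of_ideal (H N) N i) x `<=` ideal_stalk (H i) x.
Proof.
move=> _ [U [Ux [s [+ ->]]]]; rewrite /= /rees_of_ideal_sections.
case: ifP => [Ni|_] Hs; last first.
  exists U, Ux, 0; split; last by rewrite Hs.
  by case: (ideal_sections_ideal (H i) U).
have [W Wx [WU Ws]] := Hs x Ux; exists W, Wx, (res WU s).
split; last by rewrite (germ_res Ux Wx WU).
by rewrite -(divnK Ni); apply: component_ideal_pow.
Qed.

Lemma ideal_stalk_rees_of_ideal_base (I : ideal_sheaf V) N : (0 < N)%N ->
  ideal_stalk I x `<=` ideal_stalk (rees_of_ideal I N N) x.
Proof.
move=> N0 _ [U [Ux [s [Is ->]]]]; exists U, Ux, s; split => //.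
(* Positivity of [N] makes the exponent [N %/ N] equal to 1. *)
rewrite /= /rees_of_ideal_sections dvdnn divnn N0 => y Uy.
exists U => //; exists (@subset_refl _ U); rewrite res_id.
by apply: sub_ideal_gen; exists s, 1; rewrite mulr1.
Qed.

(** At a singular point the stalk of [H n] lies in the [n]-th power of the maximal ideal, so
    [gr_image] ignores none of its elements. *)
Lemma tangent_coneP (H : graded_algebra V) (P : set (gr (stalk x))) : Sing H x ->
  tangent_cone H x P <->
  prime_ideal P /\ forall n a, (0 < n)%N -> ideal_stalk (H n) x a -> form_in P n a.
Proof.
move=> xH; split=> -[primeP PH]; split => //.
  move=> n a n0 Ha; have [r ra] := rees_monomial (xH n n0 a Ha).
  exists r => //; apply: PH; apply: sub_ideal_gen.
  by exists n => //; exists r => //; exists a.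
have [idP _ _] := primeP.
move=> z; apply => // _ [n n0 [r -> [a Ha ra]]].
by apply: form_inE ra _; apply: PH.
Qed.

Lemma tangent_cone_rees_of_ideal (H : graded_algebra V) (s : nat)
    (f : 'I_s -> stalk x) (n : 'I_s -> nat) (N : nat) : Sing H x ->
  (forall i, (0 < n i)%N) -> generated_at H f n ->
  (0 < N)%N -> (forall i, (n i %| N)%N) ->
  tangent_cone H x = tangent_cone (rees_of_ideal (H N) N) x.
Proof.
move=> xH n0 Hx N0 nN.
have xHN : Sing (rees_of_ideal (H N) N) x.
  by move=> m m0 a /ideal_stalk_rees_of_ideal; apply: xH.
apply/seteqP; split=> P.
  (* The smaller algebra imposes fewer conditions on [P]. *)
  move=> /(tangent_coneP _ xH)[primeP PH]; apply/(tangent_coneP _ xHN).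
  by split=> // m a m0 /ideal_stalk_rees_of_ideal; apply: PH.
move=> /(tangent_coneP _ xHN)[primeP PHN]; apply/(tangent_coneP _ xH).
split=> // m a m0 Ha; have [idP _ _] := primeP.
have H0 j : ideal_stalk (H j) x 0.
  exists (opensT V), I, 0; split; last by rewrite -stalk_zeroE.
  by case: (ideal_sections_ideal (H j) (opensT V)).
have Hf i : ideal_stalk (H (n i)) x (f i).
  have : subalgebra_gen (range (fun i => f i *: 'X^(n i))) (f i *: 'X^(n i)).
    by move=> B _; apply; exists i.
  by rewrite -Hx => /(_ (n i)); rewrite coefZ coefXn eqxx mulr1.
have : subalgebra_gen (range (fun i => f i *: 'X^(n i))) (a *: 'X^m).
  rewrite -Hx => j; rewrite coefZ coefXn.
  by case: eqP => [->|_]; rewrite ?mulr1 // mulr0.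
(* The polynomials whose coefficients of positive degree have their forms in [P] make up a
   subalgebra, so only the generators remain to be checked. *)
move=> /(_ _ (form_in_subalgebra idP)) /= PB.
have := PB _ m m0; rewrite coefZ coefXn eqxx mulr1; apply.
move=> _ [i _ <-] j j0; rewrite coefZ coefXn.
case: eqP => [->|_]; last by rewrite mulr0; apply: form_in0.
(* This exponent moves [f i] from degree [n i] to degree exactly [N], where [PHN] applies. *)
rewrite mulr1; apply: (@form_inX _ _ _ (N %/ n i)) => //; first exact: xH.
have nNE : (n i * (N %/ n i))%N = N by rewrite mulnC divnK.
rewrite nNE; apply: PHN => //; apply: ideal_stalk_rees_of_ideal_base => //.
by rewrite -[X in H X]nNE; apply: ideal_stalk_exp.
Qed.

End IdealStalks.

Theorem lemma5p5 (k : fieldType) (V : scheme)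
    (iota : {rmorphism k -> sections (opensT V)}) (smoothV : smooth iota)
    (G : rees_algebra V) (x : V) (xG : Sing G x)
    (s : nat) (f : 'I_s -> stalk x) (n : 'I_s -> nat)
    (n_gt0 : forall i, (0 < n i)%N) (Gx : generated_at G f n)
    (N : nat) (N_gt0 : (0 < N)%N) (nN : forall i, (n i %| N)%N) :
  tau G x = tau (rees_of_ideal (G N) N) x.
Proof.
by rewrite /tau (tangent_cone_rees_of_ideal xG n_gt0 Gx N_gt0 nN).
Qed.
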